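(* Let $\psi: T \to \mathbb{C}$ be a function and $\varphi: T \to T$ a self-map with finite range (i.e. $\varphi(T)$ is a finite set) for which $W_{\psi,\varphi}$ is bounded on $L_\mu^\infty$ (respectively $L_\mu^0$). Then $W_{\psi,\varphi}$ is compact on $L_\mu^\infty$ (respectively $L_\mu^0$).
   Context: $(T,\mathrm{d})$ is a metric space with a distinguished point $o$ (the root); the length of $v \in T$ is $|v| = \mathrm{d}(o,v)$. $T$ is assumed locally finite (for every $M>0$ the set $\{v \in T : |v| < M\}$ is finite) and unbounded (for every $M>0$ there is $v \in T$ with $|v| \ge M$). $\mu: T \to (0,\infty)$ is an arbitrary positive function (a weight). $L_\mu^\infty$ is the Banach space of functions $f: T \to \mathbb{C}$ with $\|f\|_\mu = \sup_{v \in T} \mu(v)|f(v)| < \infty$, and $L_\mu^0$ is its closed subspace of those $f$ with $\lim_{|v|\to\infty} \mu(v)|f(v)| = 0$. The weighted composition operator is the linear map $W_{\psi,\varphi} f = \psi\,(f\circ\varphi)$; it is bounded (compact) on a space if it is a bounded (compact) operator from that space to itself. *)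

(* Defs.v *)
From HB Require Import structures.
From mathcomp Require Import all_boot all_order all_algebra.
From mathcomp Require Import all_classical all_reals all_analysis.
From mathcomp Require Import complex.

Set Implicit Arguments.
Unset Strict Implicit.
Unset Printing Implicit Defensive.

Import Order.TTheory GRing.Theory Num.Theory.
Import ComplexField.Normc.
Import numFieldNormedType.Exports.

Local Open Scope classical_set_scope.
Local Open Scope complex_scope.
Local Open Scope ring_scope.

Section rooted_metric_space.
Context {R : realType} {T : metricType R}.
Implicit Types o : T.

Definition vlength o (v : T) : R := mdist o v.

Definition locally_finite o :=
  forall M : R, 0 < M -> finite_set [set v | vlength o v < M].

Definition unbounded_space o :=
  forall M : R, 0 < M -> exists v, M <= vlength o v.

(* the filter "|v| tends to infinity" *)
Definition at_infinity o : set_system T :=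
  filter_from [set: R] (fun M => [set v | M <= vlength o v]).

Global Instance at_infinity_filter o : Filter (at_infinity o).
Proof.
apply: filter_from_filter; first by exists 0.
move=> a b _ _; exists (Order.max a b) => // v /=.
by rewrite ge_max => /andP[].
Qed.

End rooted_metric_space.

Section Linf.
Context {R : realType} {T : Type} (mu : T -> {posnum R}).
Implicit Types f g : T -> R[i].

Definition wabs f (v : T) : R := (mu v)%:num * normc (f v).

Definition wsup f : R := sup (range (wabs f)).

Definition linf_set : {pred T -> R[i]} :=
  mem [set f | has_ubound (range (wabs f))].

Lemma linf_setP f : reflect (exists M, forall v, wabs f v <= M) (f \in linf_set).
Proof.
apply: (iffP idP) => [/set_mem[M fM]|[M fM]].
  by exists M => v; apply: fM; exists v.
by apply/mem_set; exists M => _ [v _ <-].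
Qed.

Lemma normc_norm (z : R[i]) : `|z| = (normc z)%:C.
Proof. by case: z. Qed.

Lemma normc_ge0 (z : R[i]) : 0 <= normc z.
Proof. by rewrite -lecR -normc_norm; exact: (normr_ge0 z). Qed.

Lemma normc_triangle (y z : R[i]) : normc (y + z) <= normc y + normc z.
Proof.
by rewrite -lecR rmorphD /= -!normc_norm ler_normD.
Qed.

Lemma wabs_ge0 f v : 0 <= wabs f v.
Proof. by rewrite mulr_ge0// normc_ge0. Qed.

Lemma wabsD f g v : wabs (f + g) v <= wabs f v + wabs g v.
Proof. by rewrite -mulrDr ler_wpM2l// normc_triangle. Qed.

Lemma wabsZ (a : R[i]) f v : wabs (a *: f) v = normc a * wabs f v.
Proof. by rewrite /wabs [(a *: f) v]/(a * f v) normcM mulrCA. Qed.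

Lemma linf_submod_closed : submod_closed linf_set.
Proof.
split=> [|a f g /linf_setP[M fM] /linf_setP[N gN]]; apply/linf_setP.
  by exists 0 => v; rewrite /wabs normc0 mulr0.
exists (normc a * M + N) => v; rewrite (le_trans (wabsD _ _ _))//.
by rewrite lerD// wabsZ ler_wpM2l// normc_ge0.
Qed.

HB.instance Definition _ :=
  GRing.isSubmodClosed.Build R[i] (T -> R[i]) linf_set linf_submod_closed.

Record Linf := MkLinf { linf_fun :> T -> R[i]; _ : linf_fun \in linf_set }.

HB.instance Definition _ := [isSub for linf_fun].
HB.instance Definition _ := [Choice of Linf by <:].
HB.instance Definition _ := [SubChoice_isSubLmodule of Linf by <:].

Lemma wabs_le (f : Linf) v : wabs f v <= wsup f.
Proof.
apply: ub_le_sup; last by exists v.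
by have /set_mem := valP f.
Qed.

Lemma wsup_le f M : 0 <= M -> (forall v, wabs f v <= M) -> wsup f <= M.
Proof.
move=> M0 fM; have [e|/set0P ne] := eqVneq (range (wabs f)) set0.
  by rewrite /wsup e sup0.
by apply: ge_sup => // _ [v _ <-].
Qed.


Lemma wsup_ge0 (f : Linf) : 0 <= wsup f.
Proof.
have [e|/set0P[_ [v _ _]]] := eqVneq (range (wabs f)) set0.
  by rewrite /wsup e sup0.
exact: le_trans (wabs_ge0 f v) (wabs_le f v).
Qed.

Definition linf_norm (f : Linf) : R[i] := (wsup f)%:C.

Lemma linf_normD (f g : Linf) : linf_norm (f + g) <= linf_norm f + linf_norm g.
Proof.
rewrite -rmorphD lecR; apply: wsup_le => [|v]; first by rewrite addr_ge0// wsup_ge0.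
by rewrite (le_trans (wabsD _ _ _))// lerD// wabs_le.
Qed.

Lemma linf_normZ (a : R[i]) (f : Linf) : linf_norm (a *: f) = `|a| * linf_norm f.
Proof.
have leZ (b : R[i]) (g : Linf) : wsup (b *: g) <= normc b * wsup g.
  apply: wsup_le => [|v]; first by rewrite mulr_ge0 ?normc_ge0 ?wsup_ge0.
  by rewrite [wabs _ _]wabsZ ler_wpM2l ?normc_ge0 ?wabs_le.
rewrite normc_norm -rmorphM; congr (_%:C); apply/le_anti; rewrite leZ /=.
have [->|a0] := eqVneq a 0; first by rewrite normc0 mul0r; exact: (wsup_ge0 (0 *: f)).
have na0 : 0 < normc a.
  by rewrite lt_neqAle normc_ge0 andbT eq_sym; apply: contra a0 => /eqP/eq0_normc ->.
rewrite -ler_pdivlMl// -normcV.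
by have := leZ a^-1 (a *: f); rewrite scalerA mulVf// scale1r.
Qed.

Lemma linf_norm_eq0 (f : Linf) : linf_norm f = 0 -> f = 0.
Proof.
move=> [f0]; apply/val_inj/funext => v; apply: eq0_normc; apply/eqP.
have := wabs_le f v; rewrite f0 /wabs pmulr_rle0// => fv.
by rewrite eq_le fv normc_ge0.
Qed.

HB.instance Definition _ :=
  Lmodule_isNormed.Build R[i] Linf linf_normD linf_normZ linf_norm_eq0.

End Linf.

Section L0.
Context {R : realType} {T : metricType R} (o : T) (mu : T -> {posnum R}).

Definition l0_set : {pred Linf mu} :=
  mem [set f : Linf mu | wabs mu f v @[v --> at_infinity o] --> (0 : R)].

Lemma l0_submod_closed : submod_closed l0_set.
Proof.
split=> [|a f g /set_mem f0 /set_mem g0]; apply/mem_set => /=.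
  rewrite (_ : (fun v => _) = cst 0); first exact: cvg_cst.
  by apply/funext => v; rewrite /wabs normc0 mulr0.
apply: (@squeeze_cvgr _ _ _ _ (cst 0)
  (fun v => normc a * wabs mu f v + wabs mu g v)); last 2 first.
- exact: cvg_cst.
- by rewrite -[0]addr0 -{1}(mulr0 (normc a)); apply: cvgD => //; exact: cvgMr.
by near=> v; rewrite /= wabs_ge0 -wabsZ; exact: wabsD.
Unshelve. all: by end_near. Qed.

HB.instance Definition _ :=
  GRing.isSubmodClosed.Build R[i] (Linf mu) l0_set l0_submod_closed.

Record L0 := MkL0 { l0_linf :> Linf mu; _ : l0_linf \in l0_set }.

HB.instance Definition _ := [isSub for l0_linf].
HB.instance Definition _ := [Choice of L0 by <:].
HB.instance Definition _ := [SubChoice_isSubLmodule of L0 by <:].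

Definition l0_norm (f : L0) : R[i] := `|l0_linf f|.

Lemma l0_normD (f g : L0) : l0_norm (f + g) <= l0_norm f + l0_norm g.
Proof. exact: ler_normD. Qed.

Lemma l0_normZ (a : R[i]) (f : L0) : l0_norm (a *: f) = `|a| * l0_norm f.
Proof. exact: normrZ. Qed.

Lemma l0_norm_eq0 (f : L0) : l0_norm f = 0 -> f = 0.
Proof. by move=> /normr0_eq0 f0; exact/val_inj. Qed.

HB.instance Definition _ :=
  Lmodule_isNormed.Build R[i] L0 l0_normD l0_normZ l0_norm_eq0.

End L0.

Section operators.
Context {K : numFieldType} {V : normedModType K}.

Definition bounded_operator (A : {linear V -> V}) :=
  exists M : K, forall x, `|A x| <= M * `|x|.

Definition compact_operator (A : {linear V -> V}) :=
  compact (closure (A @` [set x | `|x| <= 1])).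

End operators.

Section weighted_composition.
Context {R : realType} {T : Type}.

Definition wcomp (psi : T -> R[i]) (phi : T -> T) (f : T -> R[i]) : T -> R[i] :=
  fun v => psi v * f (phi v).

(* V stands for a space of functions on T, and ev sends its elements to the
   underlying functions. The operator A is unique when ev is injective; that it
   exists says that W_(psi, phi) maps V into itself. *)
Definition wcomp_on (V : normedModType R[i]) (ev : V -> T -> R[i])
    (psi : T -> R[i]) (phi : T -> T) (P : {linear V -> V} -> Prop) :=
  exists A : {linear V -> V}, (forall f, ev (A f) = wcomp psi phi (ev f)) /\ P A.

End weighted_composition.

Section weighted_composition_spaces.
Context {R : realType} {T : metricType R} (o : T) (mu : T -> {posnum R}).
Variables (psi : T -> R[i]) (phi : T -> T).

Definition wcomp_bounded_Linf :=
  wcomp_on (fun f : Linf mu => f : T -> R[i]) psi phi bounded_operator.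

Definition wcomp_compact_Linf :=
  wcomp_on (fun f : Linf mu => f : T -> R[i]) psi phi compact_operator.

Definition wcomp_bounded_L0 :=
  wcomp_on (fun f : L0 o mu => f : T -> R[i]) psi phi bounded_operator.

Definition wcomp_compact_L0 :=
  wcomp_on (fun f : L0 o mu => f : T -> R[i]) psi phi compact_operator.

End weighted_composition_spaces.

(* Main.v *)
(** When [phi] has finite range, [W f] depends only on the values of [f] at the
    finitely many points [w] of that range, so [W f = \sum_w f w *: W 1_w].
    On the unit ball [|f w| <= 1 / mu w], hence the image of the ball consists
    of linear combinations of finitely many fixed vectors with bounded
    coefficients, and these lie in a compact set. *)

Require Import Defs.
From mathcomp Require Import all_boot all_order all_algebra.
From mathcomp Require Import all_classical all_reals all_analysis.
From mathcomp Require Import complex.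

Import Order.TTheory GRing.Theory Num.Theory.
Import ComplexField.Normc.
Import numFieldNormedType.Exports.

Local Open Scope classical_set_scope.
Local Open Scope complex_scope.
Local Open Scope ring_scope.

(* [complex R] itself carries no topology: the library puts one on the carrier
   of an explicit [numFieldType] structure. *)
Local Notation CC R := (Num.NumField.sort (R[i] : numFieldType)).

Lemma continuous_real_complex (R : realType) :
  continuous (fun x : R => x%:C : CC R).
Proof.
move=> x; apply/cvgrPdist_lt => e e0.
(* In the order of [R[i]], [0 < e] forces [e] to be real, so its real part serves as the radius in
   [R]. *)
have e1 : 0 < complex.Re e by move: e0; rewrite ltcE => /andP[].
have eE : e = (complex.Re e)%:C by rewrite RRe_real ?gtr0_real.
near=> y; rewrite eE -rmorphB normc_norm ltcR /= expr0n addr0 sqrtr_sqr.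
near: y; exact: (@cvgr_dist_lt _ R^o).
Unshelve. all: by end_near. Qed.

(** The disc sits inside the image of the square [[- M, M]] x [[- M, M]] under the continuous map
    [(x, y) |-> x + i y]. *)
Lemma closed_disc_in_compact (R : realType) (M : R) :
  exists2 C : set (CC R), compact C & [set z | `|z| <= M%:C] `<=` C.
Proof.
have cI : compact `[- M, M]%classic by exact: segment_compact.
pose h (p : R * R) : CC R := p.1%:C + 'i%C * p.2%:C.
have ch : continuous h.
  move=> p; apply: cvgD.
    by apply: (@continuous_comp _ _ _ fst (fun x : R => x%:C : CC R));
      [exact: cvg_fst | exact: continuous_real_complex].
  apply: cvgMr; apply: (@continuous_comp _ _ _ snd (fun x : R => x%:C : CC R));
    [exact: cvg_snd | exact: continuous_real_complex].
exists (h @` (`[- M, M] `*` `[- M, M])%classic).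
  apply: continuous_compact; last exact: compact_setX.
  exact: continuous_subspaceT.
move=> [x y]; rewrite /= normc_norm lecR /= => xyM.
have le_sqrt (a b : R) : `|a| <= Num.sqrt (a ^+ 2 + b ^+ 2).
  by rewrite -sqrtr_sqr ler_wsqrtr // lerDl sqr_ge0.
exists (x, y); last by rewrite /h /=; simpc.
split; rewrite /= in_itv /= -ler_norml (le_trans _ xyM) ?le_sqrt //.
by rewrite addrC le_sqrt.
Qed.

(** Induction on [s]: each new vector [g i] replaces [C] by the image of [D * C] under
    [(z, v) |-> z *: g i + v], where [D] is compact and contains the disc of radius [M i]. The set
    is chosen before [c], hence is uniform in the coefficients. *)
Lemma bounded_combinations_in_compact (R : realType) (V : normedModType R[i])
    (I : Type) (s : seq I) (g : I -> V) (M : I -> R) :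
  exists2 C : set V, compact C &
    forall c : I -> R[i], (forall i, `|c i| <= (M i)%:C) ->
      C (\sum_(i <- s) c i *: g i).
Proof.
elim: s => [|i s [C cC CP]].
  by exists [set 0]; [exact: compact_set1 | move=> c _; rewrite big_nil].
have [D cD DP] := closed_disc_in_compact R (M i).
pose h (p : CC R * V) := p.1 *: g i + p.2.
exists (h @` (D `*` C)).
  apply: continuous_compact; last exact: compact_setX.
  apply: continuous_subspaceT => p.
  by apply: cvgD; [apply: cvgZr_tmp; exact: cvg_fst | exact: cvg_snd].
move=> c cM; rewrite big_cons; exists (c i, \sum_(j <- s) c j *: g j) => //.
by split; [exact/DP/cM | exact: CP].
Qed.

Lemma compact_operator_finite_rank (R : realType) (V : normedModType R[i])
    (A : {linear V -> V}) (I : Type) (s : seq I) (g : I -> V) (M : I -> R)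
    (c : V -> I -> R[i]) :
  (forall f i, `|f| <= 1 -> `|c f i| <= (M i)%:C) ->
  (forall f, A f = \sum_(i <- s) c f i *: g i) -> compact_operator A.
Proof.
move=> cM AE.
have [C cC CP] := bounded_combinations_in_compact R V I s g M.
apply: (subclosed_compact _ cC); first exact: closed_closure.
(* A normed space is Hausdorff, so [C] equals its closure, and it suffices to put the image of the
   ball inside [C]. *)
have /closure_id-> : closed C by exact: compact_closed (@norm_hausdorff _ _) cC.
by apply: closure_subset => _ [f /= f1 <-]; rewrite AE; apply: CP => i; exact: cM.
Qed.

(** Abstracting the space as [V] with evaluation [ev] and point masses [delta] treats [Linf] and
    [L0] at once. *)
Lemma wcomp_compact_of_finite_range (R : realType) (T : choiceType)
    (V : normedModType R[i]) (ev : {linear V -> (T -> R[i])})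
    (delta : T -> V) (M : T -> R) (psi : T -> R[i]) (phi : T -> T) :
  injective ev ->
  (forall w v, ev (delta w) v = (v == w)%:R) ->
  (forall f w, `|f| <= 1 -> `|ev f w| <= (M w)%:C) ->
  finite_set (range phi) ->
  wcomp_on ev psi phi bounded_operator -> wcomp_on ev psi phi compact_operator.
Proof.
move=> ev_inj deltaE evM /finite_seqP[s phis] [A [AE _]]; exists A; split=> //.
(* [undup] lists each point of the range once, so that exactly one term survives at [phi v]. *)
apply: (compact_operator_finite_rank _ _ _ _ (undup s) (A \o delta) M ev evM).
(* With [A] pulled out of the sum, both sides carry the factor [psi v]; it remains to compare [f]
   with its combination of point masses at [phi v]. *)
move=> f; rewrite -[RHS](eq_bigr _ (fun w _ => linearZ_LR _ _ _)) -linear_sum.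
apply: ev_inj; rewrite !AE; apply/funext => v; rewrite /wcomp; congr (_ * _).
rewrite linear_sum fct_sumE (bigD1_seq (phi v)) ?undup_uniq //=; last first.
  rewrite mem_undup; have : range phi (phi v) by exists v.
  by rewrite phis.
rewrite linearZ_LR /= [X in X + _](_ : _ = ev f (phi v) * ev (delta (phi v)) (phi v)) //.
rewrite deltaE eqxx mulr1 big1 ?addr0 // => w wv.
rewrite linearZ_LR [LHS](_ : _ = ev f w * ev (delta w) (phi v)) //.
by rewrite deltaE eq_sym (negbTE wv) mulr0.
Qed.

Section point_masses.
Context {R : realType} {T : metricType R} (o : T) (mu : T -> {posnum R}).

Let mass (w v : T) : R[i] := (v == w)%:R.

Lemma mass_linf w : mass w \in linf_set mu.
Proof.
apply/linf_setP; exists (mu w)%:num => v; rewrite /wabs /mass.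
by have [->|_] := eqVneq v w; rewrite ?normc1 ?mulr1 // normc0 mulr0.
Qed.

Definition linf_mass w : Linf mu := MkLinf (mass_linf w).

Lemma linf_mass_l0 w : linf_mass w \in l0_set (mu := mu) o.
Proof.
apply/mem_set => /=; apply: cvg_near_cst.
(* Neighbourhoods of infinity are given by a non-strict bound, so the [+ 1] is what excludes
   [v = w]. *)
exists (vlength o w + 1) => // v /= vw; rewrite /wabs /= /mass.
have [vw'|_] := eqVneq v w; last by rewrite normc0 mulr0.
by move: vw; rewrite vw' gerDl ler10.
Qed.

Definition l0_mass w : L0 o mu := MkL0 (linf_mass_l0 w).

Lemma linf_eval_le (f : Linf mu) w : `|f| <= 1 -> `|f w| <= ((mu w)%:num^-1)%:C.
Proof.
rewrite -[`|f|]/((wsup mu f)%:C) -[1]/(1%:C) normc_norm !lecR => f1.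
by rewrite -[leRHS]mulr1 ler_pdivlMl // (le_trans (wabs_le f w)).
Qed.

End point_masses.

Theorem theorem4p2 (R : realType) (T : metricType R) (o : T)
    (mu : T -> {posnum R}) (psi : T -> R[i]) (phi : T -> T) :
  locally_finite o -> unbounded_space o ->
  finite_set (range phi) ->
  (wcomp_bounded_Linf mu psi phi -> wcomp_compact_Linf mu psi phi) /\
  (wcomp_bounded_L0 o mu psi phi -> wcomp_compact_L0 o mu psi phi).
Proof.
move=> _ _ phi_fin; split.
  apply: (wcomp_compact_of_finite_range R T (Linf mu) val (linf_mass mu)
    (fun w => (mu w)%:num^-1)) => //.
  exact: linf_eval_le.
apply: (wcomp_compact_of_finite_range R T (L0 o mu) (val \o val) (l0_mass o mu)
  (fun w => (mu w)%:num^-1)) => //.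
  exact: inj_comp val_inj val_inj.
(* The norm of [L0] is that of the underlying element of [Linf], so the same bound applies. *)
by move=> f w; exact: (linf_eval_le mu (l0_linf f) w).
Qed.
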